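(* Let $s,d$ be integers with $1\le s\le d$ and let $\ell\in\mathcal L$. For any $a>0,\tau>0$, $$\inf_{\hat T}\sup_{P_\xi\in\mathcal G_{a,\tau}}\sup_{\sigma>0}\sup_{\theta\in\Theta_s}\mathbf E_{\theta,P_\xi,\sigma}\,\ell\Big(c\,\big(\sqrt s\log^{1/a}(ed/s)\big)^{-1}\Big|\frac{\hat T-\|\theta\|_2}{\sigma}\Big|\Big)\ge c',$$ and for any $a\ge2,\tau>0$, $$\inf_{\hat T}\sup_{P_\xi\in\mathcal P_{a,\tau}}\sup_{\sigma>0}\sup_{\theta\in\Theta_s}\mathbf E_{\theta,P_\xi,\sigma}\,\ell\Big(\bar c\,\big(\sqrt s(d/s)^{1/a}\big)^{-1}\Big|\frac{\hat T-\|\theta\|_2}{\sigma}\Big|\Big)\ge \bar c',$$ where $c,\bar c,c',\bar c'>0$ are constants depending only on $\ell$, $\tau$ and $a$.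
   Context: Model: $Y_i=\theta_i+\sigma\xi_i$, $i=1,\dots,d$, with $\theta\in\mathbb R^d$, $\sigma>0$, $\xi_i$ i.i.d. with distribution $P_\xi$, $\mathbf E\xi_1=0$, $\mathbf E\xi_1^2=1$; $\mathbf E_{\theta,P_\xi,\sigma}$ is expectation under this model; $\Theta_s=\{\theta:\|\theta\|_0\le s\}$ ($\|\theta\|_0$ = number of nonzero coordinates). For $a,\tau>0$, $\mathcal G_{a,\tau}$: distributions with $\mathbf E\xi_1=0,\mathbf E\xi_1^2=1$, $\mathbf P(|\xi_1|>t)\le2e^{-(t/\tau)^a}$ for all $t\ge2$; for $a\ge2,\tau>0$, $\mathcal P_{a,\tau}$: such distributions with $\mathbf P(|\xi_1|>t)\le(\tau/t)^a$ for all $t\ge2$. $\mathcal L$ is the set of nondecreasing $\ell:[0,\infty)\to[0,\infty)$ with $\ell(0)=0$, $\ell\not\equiv0$. $\inf_{\hat T}$ is the infimum over all estimators (measurable functions of $Y$). *)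

(* Defs.v *)
From HB Require Import structures.
From mathcomp Require Import all_boot all_order all_algebra.
From mathcomp Require Import all_classical all_reals all_analysis.
Set Implicit Arguments. Unset Strict Implicit. Unset Printing Implicit Defensive.
Import Order.TTheory GRing.Theory Num.Theory.
Import numFieldNormedType.Exports.
Local Open Scope classical_set_scope.
Local Open Scope ring_scope.

Section defs.
Variable R : realType.

(* The class L of loss functions: nondecreasing on [0,oo), l(0)=0, nonneg,
   and not identically zero on [0,oo).  (Only values on [0,oo) are used.) *)
Definition loss_class (l : R -> R) : Prop :=
  [/\ (forall x y, 0 <= x -> x <= y -> l x <= l y),
      l 0 = 0,
      (forall x, 0 <= x -> 0 <= l x) &
      (exists x, 0 <= x /\ l x != 0)].

Definition centered_unit_var (P : probability R R) : Prop :=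
  [/\ P.-integrable setT (fun x : R => x%:E),
      (\int[P]_x (x%:E) = 0)%E &
      (\int[P]_x ((x ^+ 2)%:E) = 1)%E].

Definition subweibull_class (a tau : R) (P : probability R R) : Prop :=
  centered_unit_var P /\
  forall t : R, 2 <= t ->
    (P [set x : R | (t < `|x|)%R] <= (2 * expR (- ((t / tau) `^ a)))%:E)%E.

Definition polytail_class (a tau : R) (P : probability R R) : Prop :=
  centered_unit_var P /\
  forall t : R, 2 <= t ->
    (P [set x : R | (t < `|x|)%R] <= ((tau / t) `^ a)%:E)%E.

(* Expectation of f(xi_1,...,xi_n) for xi_i i.i.d. with law P, i.e. the
   integral of f against the product measure P^{(x)n}, written as an iterated
   integral (Tonelli; f will always be nonnegative). *)
Fixpoint prod_expect (P : probability R R) (n : nat) :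
  (n.-tuple R -> \bar R) -> \bar R :=
  match n with
  | 0 => fun f => f [tuple]
  | n'.+1 => fun f => (\int[P]_x prod_expect P (fun t => f (cons_tuple x t)))%E
  end.

Definition l0norm (d : nat) (th : d.-tuple R) : nat :=
  #|[set i : 'I_d | tnth th i != 0]|.

Definition l2norm (d : nat) (th : d.-tuple R) : R :=
  Num.sqrt (\sum_(i < d) tnth th i ^+ 2).

Definition obs (d : nat) (th : d.-tuple R) (sigma : R) (xi : d.-tuple R)
  : d.-tuple R := [tuple tnth th i + sigma * tnth xi i | i < d].

Definition risk (l : R -> R) (k : R) (d : nat) (T : d.-tuple R -> R)
  (P : probability R R) (sigma : R) (th : d.-tuple R) : \bar R :=
  prod_expect P (fun xi : d.-tuple R =>
    (l (k * (`|T (obs th sigma xi) - l2norm th| / sigma)))%:E).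

Definition max_risk (cls : probability R R -> Prop) (l : R -> R) (k : R)
  (s d : nat) (T : d.-tuple R -> R) : \bar R :=
  ereal_sup [set r : \bar R | exists (P : probability R R) (sigma : R)
     (th : d.-tuple R), [/\ cls P, 0 < sigma, (l0norm th <= s)%N &
        r = risk l k T P sigma th]].

End defs.

(* Main.v *)
(* Proof idea.  Let delta_i be i.i.d. Bernoulli of parameter p = s / (2 d), and
   eta_i, eps_i independent random signs.  The observation
   Y_i = h delta_i eta_i + eps_i can be read in two ways: as pure noise
   (theta = 0, sigma^2 = 1 + p h^2, noise Y_i / sigma), or as the random vector
   theta = h delta eta observed in Rademacher noise (sigma = 1).  The noise of
   the first reading belongs to the class as soon as h is of the order of the
   quantile of level p allowed by the tail bound, that is log^(1/a)(ed/s),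
   respectively (d/s)^(1/a), up to constants; then p h^2, hence sigma, stays
   bounded.  In the second reading the number N of nonzero coordinates lies in
   [s/12, s] with probability at least 1/8, and then the norm of theta is
   h sqrt N, of order h sqrt s.  No estimator can be close to both 0 and
   h sqrt N. *)
Require Import Defs.
From HB Require Import structures.
From mathcomp Require Import all_boot all_order all_algebra.
From mathcomp Require Import all_classical all_reals all_analysis.
From mathcomp Require Import measurable_realfun ring lra.
Import Order.TTheory GRing.Theory Num.Theory.
Import numFieldNormedType.Exports.
Local Open Scope classical_set_scope.
Local Open Scope ring_scope.

(** * Finitely supported laws on the real line *)

Section DiscreteLaw.
Context {R : realType} {J : finType}.
Variables (w x : J -> R) (w0 : forall j, 0 <= w j).

(** Indexed by [nat] because [msum] adds up a sequence of measures; indices from [#|J|] on get the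
    zero measure. *)
Definition atom (k : nat) : {measure set R -> \bar R} :=
  if insub k is Some i
  then mscale (NngNum (w0 (enum_val (i : 'I_#|J|)))) (\d_(x (enum_val i)))
  else mzero.

Definition discrete_law : set R -> \bar R := msum atom #|J|.

HB.instance Definition _ := Measure.on discrete_law.

Lemma discrete_lawE (A : set R) :
  discrete_law A = (\sum_j (w j)%:E * \d_(x j) A)%E.
Proof.
rewrite /discrete_law /msum (reindex _ (onW_bij _ (enum_val_bij J)))/=.
by apply: eq_bigr => i _; rewrite /atom valK.
Qed.

Lemma ge0_integral_discrete_law (f : R -> \bar R) :
  (forall y, (0 <= f y)%E) -> measurable_fun setT f ->
  (\int[discrete_law]_y f y = \sum_j (w j)%:E * f (x j))%E.
Proof.
move=> f0 mf; rewrite /discrete_law ge0_integral_measure_sum//.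
rewrite (reindex _ (onW_bij _ (enum_val_bij J)))/=.
apply: eq_bigr => i _; rewrite /atom valK ge0_integral_mscale//.
by rewrite integral_dirac// diracT mul1e.
Qed.

Lemma integral_discrete_law (f : R -> R) : measurable_fun setT f ->
  (\int[discrete_law]_y (f y)%:E = (\sum_j w j * f (x j))%:E)%E.
Proof.
move=> mf; have mEf : measurable_fun setT (EFin \o f) by exact/measurable_EFinP.
rewrite integralE !ge0_integral_discrete_law//; last 2 first.
- exact: measurable_funeneg.
- exact: measurable_funepos.
under eq_bigr do rewrite funeposE -EFin_max -EFinM.
under [X in (_ - X)%E]eq_bigr do rewrite funenegE -EFinN -EFin_max -EFinM.
rewrite !sumEFin -EFinB -sumrB; congr EFin; apply: eq_bigr => j _.
rewrite -mulrBr; congr (_ * _).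
by rewrite !maxr_absE !subr0 normrN; field.
Qed.

Lemma integrable_discrete_law (f : R -> R) : measurable_fun setT f ->
  discrete_law.-integrable setT (fun y => (f y)%:E).
Proof.
move=> mf; apply/integrableP; split; first exact/measurable_EFinP.
rewrite (_ : (fun y => _) = fun y => (`|f y|)%:E)//.
rewrite integral_discrete_law ?ltry//.
exact: measurableT_comp.
Qed.

(* No measurability of [f] is needed: the integral is a supremum over the
   simple functions below [f], and [g] below is one with the right values at
   the atoms. *)
Lemma discrete_law_le_integral (f : R -> \bar R) (v : J -> R) :
  (forall y, (0 <= f y)%E) -> (forall j, 0 <= v j) ->
  (forall j, ((v j)%:E <= f (x j))%E) ->
  ((\sum_j w j * v j)%:E <= \int[discrete_law]_y f y)%E.
Proof.
move=> f0 v0 vf.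
(* A maximum rather than a sum, since several atoms may sit at the same point, where a sum could
   exceed [f]. *)
pose g y := \big[Num.max/0]_j (v j * \1_[set x j] y).
have g0 y : 0 <= g y.
  rewrite /g; elim/big_ind : _ => // [a b a0 b0|j _]; first by rewrite le_max a0.
  by rewrite mulr_ge0.
have mg : measurable_fun setT g.
  rewrite /g; elim: (index_enum J) => [|j r IH].
    by under eq_fun do rewrite big_nil; exact: measurable_cst.
  under eq_fun do rewrite big_cons.
  apply: measurable_maxr => //; apply: measurable_funM => //.
have gf y : ((g y)%:E <= f y)%E.
  rewrite /g; elim/big_ind : _ => //= [a b ha hb|j _].
    by rewrite EFin_max ge_max ha hb.
  rewrite indicE; case: (pselect (y = x j)) => [->|yx].
    by rewrite mem_set// mulr1.
  by rewrite memNset// mulr0.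
apply: (@le_trans _ _ (\int[discrete_law]_y (g y)%:E)%E).
  rewrite integral_discrete_law// lee_fin; apply: ler_sum => j _.
  apply: ler_wpM2l => //; rewrite /g (bigD1 j)//= le_max indicE mem_set//.
  by rewrite mulr1 lexx.
rewrite !ge0_integralTE//; apply: le_ereal_sup => _ /= [h hg <-].
by exists h => // y; exact: le_trans (hg y) (gf y).
Qed.

Hypothesis w1 : \sum_j w j = 1.

Let discrete_law_setT : discrete_law setT = 1%E.
Proof.
rewrite discrete_lawE; under eq_bigr do rewrite diracT mule1.
by rewrite sumEFin w1.
Qed.

HB.instance Definition _ :=
  Measure_isProbability.Build _ _ _ discrete_law discrete_law_setT.

Definition discrete_prob : probability R R := discrete_law.

End DiscreteLaw.

(** * Means over finite i.i.d. sequences *)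

Section IidMean.
Context {R : realType} {J : finType}.
Implicit Types (w : J -> R) (F G : seq J -> R).

(** The finite analogue of [prod_expect], on sequences so that the induction on [n] is a plain
    cons. *)
Fixpoint iid_mean w (n : nat) F : R :=
  if n is n'.+1 then \sum_j w j * iid_mean w n' (fun t => F (j :: t)) else F [::].

Lemma ler_iid_mean w n F G : (forall j, 0 <= w j) ->
  (forall t, size t = n -> F t <= G t) -> iid_mean w n F <= iid_mean w n G.
Proof.
move=> w0; elim: n F G => [|n IH] F G FG /=; first exact: FG.
apply: ler_sum => j _; apply: ler_wpM2l => //.
by apply: IH => t st; apply: FG; rewrite /= st.
Qed.

Lemma eq_iid_mean w n F G : F =1 G -> iid_mean w n F = iid_mean w n G.
Proof. by move=> /funext->. Qed.

Lemma iid_meanD w n F G :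
  iid_mean w n (fun t => F t + G t) = iid_mean w n F + iid_mean w n G.
Proof.
elim: n F G => [//|n IH] F G /=; rewrite -big_split/=.
by apply: eq_bigr => j _; rewrite IH mulrDr.
Qed.

Lemma iid_meanZ w n c F : iid_mean w n (fun t => c * F t) = c * iid_mean w n F.
Proof.
elim: n F => [//|n IH] F /=; rewrite mulr_sumr.
by apply: eq_bigr => j _; rewrite IH mulrCA.
Qed.

Lemma iid_mean_sum w n (I : finType) (v : I -> R) (F : I -> seq J -> R) :
  iid_mean w n (fun t => \sum_i v i * F i t) = \sum_i v i * iid_mean w n (F i).
Proof.
elim: n F => [//|n IH] F /=.
under eq_bigr do rewrite IH mulr_sumr.
rewrite exchange_big; apply: eq_bigr => i _.
by rewrite mulr_sumr; apply: eq_bigr => j _; rewrite mulrCA.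
Qed.

Lemma iid_mean_cst w n c : \sum_j w j = 1 -> iid_mean w n (fun=> c) = c.
Proof.
move=> w1; elim: n => [//|n IH] /=.
by under eq_bigr do rewrite IH; rewrite -mulr_suml w1 mul1r.
Qed.

Lemma iid_mean_count w n (a : pred J) (p : R) :
  \sum_j w j = 1 -> \sum_(j | a j) w j = p ->
  iid_mean w n (fun t => (count a t)%:R) = n%:R * p.
Proof.
move=> w1 wp; elim: n => [|n IH] /=; first by rewrite mul0r.
under eq_bigr => j _.
  under eq_iid_mean do rewrite natrD.
  rewrite iid_meanD iid_mean_cst// IH mulrDr; over.
rewrite big_split/= -mulr_suml w1 -natr1 mulrDl !mul1r addrC; congr (_ + _).
rewrite -wp [RHS]big_mkcond/=; apply: eq_bigr => j _.
by case: (a j); rewrite ?mulr1 ?mulr0.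
Qed.

Lemma iid_mean_count_sqr w n (a : pred J) (p : R) :
  \sum_j w j = 1 -> \sum_(j | a j) w j = p ->
  iid_mean w n (fun t => (count a t)%:R ^+ 2) =
  n%:R * (p - p ^+ 2) + (n%:R * p) ^+ 2.
Proof.
move=> w1 wp; elim: n => [|n IH] /=; first by rewrite !mul0r expr0n addr0.
(* An indicator is its own square, so only the first two moments of the shorter count enter. *)
have sqrE j t : (a j + count a t)%:R ^+ 2 = (a j)%:R +
    ((2 * (a j)%:R) * (count a t)%:R + (count a t)%:R ^+ 2) :> R.
  by rewrite natrD; case: (a j) => /=; ring.
have stepE j : w j * iid_mean w n (fun t => (a j + count a t)%:R ^+ 2) =
    (1 + 2 * (n%:R * p)) * (w j * (a j)%:R) +
    w j * (n%:R * (p - p ^+ 2) + (n%:R * p) ^+ 2).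
  rewrite (eq_iid_mean _ _ _ _ (sqrE j)) !iid_meanD iid_mean_cst// iid_meanZ.
  by rewrite (iid_mean_count _ _ _ _ w1 wp) IH; ring.
under eq_bigr do rewrite stepE.
rewrite big_split/= -mulr_suml -mulr_sumr w1 (_ : \sum_j _ = p); last first.
  rewrite -wp [RHS]big_mkcond/=; apply: eq_bigr => j _.
  by case: (a j); rewrite ?mulr1 ?mulr0.
by rewrite -natr1; ring.
Qed.

End IidMean.

(** Separates signal from noise: averaging over the mixture is averaging over the noise for a fixed
    signal, then over the signal. This links the two readings of the observation. *)
Lemma iid_mean_zip {R : realType} {A B : finType} (v : A -> R) (w : B -> R) n
    (F : seq (A * B) -> R) :
  iid_mean (fun c => v c.1 * w c.2) n F =
  iid_mean v n (fun a => iid_mean w n (fun b => F (zip a b))).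
Proof.
elim: n F => [//|n IH] F /=.
transitivity (\sum_i \sum_j v i * w j *
    iid_mean (fun c => v c.1 * w c.2) n (fun t => F ((i, j) :: t))).
  by rewrite pair_bigA; apply: eq_bigr => -[].
apply: eq_bigr => i _; rewrite iid_mean_sum mulr_sumr.
by apply: eq_bigr => j _; rewrite IH mulrA.
Qed.

(** * From finite means to expectations under product laws *)

Definition tuple_map {R : realType} {J : Type} (n : nat) (x : J -> R)
  (t : seq J) : n.-tuple R := [tuple nth 0 (map x t) i | i < n].

Lemma prod_expect_ge0 {R : realType} (P : probability R R) n
    (f : n.-tuple R -> \bar R) :
  (forall t, (0 <= f t)%E) -> (0 <= prod_expect P f)%E.
Proof.
elim: n f => [|n IH] f f0 /=; first exact: f0.
by apply: integral_ge0 => x _; exact: IH.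
Qed.

(** One inequality suffices to bound risks from below; it comes from [discrete_law_le_integral],
    applied one coordinate at a time. *)
Lemma iid_mean_le_prod_expect {R : realType} {J : finType} (w x : J -> R)
    (w0 : forall j, 0 <= w j) (w1 : \sum_j w j = 1) n (f : n.-tuple R -> R) :
  (forall t, 0 <= f t) ->
  ((iid_mean w n (fun t => f (tuple_map n x t)))%:E <=
   prod_expect (discrete_prob w x w0 w1) (fun t => (f t)%:E))%E.
Proof.
elim: n f => [|n IH] f f0 /=.
  by rewrite (_ : tuple_map 0 x [::] = [tuple])//; exact: tuple0.
apply: discrete_law_le_integral => [y|j|j].
- by apply: prod_expect_ge0 => t; rewrite lee_fin.
- rewrite -[leLHS](iid_mean_cst w n _ w1).
  by apply: ler_iid_mean => // t _.
- rewrite (_ : (fun t => _) =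
    fun t => f (cons_tuple (x j) (tuple_map n x t))); last first.
    apply/funext => t; congr f; apply: eq_from_tnth => i.
    rewrite tnth_mktuple (tnth_nth 0)/=.
    case: i => [[|i] iltn]//=.
    have it : (i < n)%N by [].
    by rewrite -[RHS](tnth_nth 0 (tuple_map n x t) (Ordinal it)) tnth_mktuple.
  exact: IH.
Qed.

Lemma centered_unit_var_discrete {R : realType} {J : finType} (w x : J -> R)
    (w0 : forall j, 0 <= w j) (w1 : \sum_j w j = 1) :
  \sum_j w j * x j = 0 -> \sum_j w j * x j ^+ 2 = 1 ->
  centered_unit_var (discrete_prob w x w0 w1).
Proof.
move=> m1 m2; split.
- exact: integrable_discrete_law.
- by rewrite integral_discrete_law// m1.
- by rewrite integral_discrete_law ?m2//; exact: exprn_measurable.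
Qed.

Lemma discrete_law_tail {R : realType} {J : finType} (w x : J -> R)
    (w0 : forall j, 0 <= w j) (t : R) :
  discrete_law w x w0 [set y | (t < `|y|)%R] =
  (\sum_(j | t < `|x j|) w j)%:E.
Proof.
rewrite discrete_lawE -sumEFin [RHS]big_mkcond/=; apply: eq_bigr => j _.
rewrite diracE; case: ifPn => tx; first by rewrite mem_set//= mule1.
by rewrite memNset ?mule0//= ; exact/negP.
Qed.

Lemma sum_pair {R : realType} {A B : finType} (F : A * B -> R) :
  \sum_c F c = \sum_a \sum_b F (a, b).
Proof. by rewrite pair_bigA; apply: eq_bigr => -[]. Qed.

Lemma sum_tuple_map {R : realType} {J : Type} (F x : J -> R) (G : R -> R) n t :
  size t = n -> (forall j, G (x j) = F j) ->
  \sum_(i < n) G (tnth (tuple_map n x t) i) = \sum_(j <- t) F j.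
Proof.
move=> <- GF; under eq_bigr do rewrite tnth_mktuple.
rewrite -(big_mkord xpredT (fun i => G (nth 0 (map x t) i))).
rewrite -(size_map x t) -(big_nth 0 xpredT G) big_map.
by apply: eq_bigr.
Qed.

(** * The contaminated Rademacher noise and its two readings *)

Section Contamination.
Context {R : realType}.
Variables (p h : R).
Hypotheses (p0 : 0 <= p) (p1 : p <= 1) (h0 : 0 < h).

Definition sgnb (b : bool) : R := (-1) ^+ b.
Definition coin (b : bool) : R := 2^-1.

(** Law of the indicator and the sign; the sign is drawn even where the indicator vanishes, so each
    value of [a.1] splits its mass equally. *)
Definition prior (a : bool * bool) : R := (if a.1 then p else 1 - p) / 2.
Definition signal (a : bool * bool) : R := if a.1 then h * sgnb a.2 else 0.
Definition mixed (c : bool * bool * bool) : R := signal c.1 + sgnb c.2.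
Definition mixed_weight (c : bool * bool * bool) : R := prior c.1 * coin c.2.
Definition mixed_sd : R := Num.sqrt (1 + p * h ^+ 2).

Lemma coin_ge0 b : 0 <= coin b.
Proof. by rewrite invr_ge0. Qed.

Lemma prior_ge0 a : 0 <= prior a.
Proof. by rewrite divr_ge0//; case: ifP => // _; rewrite subr_ge0. Qed.

Lemma mixed_weight_ge0 c : 0 <= mixed_weight c.
Proof. by rewrite mulr_ge0 ?prior_ge0 ?coin_ge0. Qed.

Lemma sum_coin : \sum_b coin b = 1.
Proof. by rewrite big_bool /coin/=; field. Qed.

Lemma sum_prior : \sum_a prior a = 1.
Proof. by rewrite sum_pair !big_bool /prior/=; field. Qed.

Lemma sum_prior_signal : \sum_(a | a.1) prior a = p.
Proof. by rewrite big_mkcond sum_pair !big_bool /prior/=; field. Qed.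

Lemma sum_mixed_weight : \sum_c mixed_weight c = 1.
Proof.
by rewrite sum_pair sum_pair !big_bool /mixed_weight /prior /coin/=; field.
Qed.

Lemma mixed_sd_ge1 : 1 <= mixed_sd.
Proof.
rewrite -[leLHS]sqrtr1 ler_wsqrtr// lerDl mulr_ge0// sqr_ge0//.
Qed.

Lemma mixed_sd_gt0 : 0 < mixed_sd.
Proof. exact: lt_le_trans mixed_sd_ge1. Qed.

Definition rademacher : probability R R :=
  discrete_prob coin sgnb coin_ge0 sum_coin.

Definition mixed_law : probability R R :=
  discrete_prob mixed_weight (fun c => mixed c / mixed_sd)
    mixed_weight_ge0 sum_mixed_weight.

Lemma rademacher_centered : centered_unit_var rademacher.
Proof.
apply: centered_unit_var_discrete; rewrite big_bool /coin /sgnb/= ?expr0 ?expr1.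
  by field.
by field.
Qed.

Lemma mixed_law_centered : centered_unit_var mixed_law.
Proof.
have sd0 : mixed_sd != 0 by rewrite gt_eqF// mixed_sd_gt0.
have sdE : mixed_sd ^+ 2 = 1 + p * h ^+ 2.
  by rewrite sqr_sqrtr// addr_ge0// mulr_ge0// sqr_ge0.
apply: centered_unit_var_discrete.
  rewrite sum_pair sum_pair !big_bool /mixed_weight /mixed /prior /coin /signal.
  by rewrite /sgnb/= ?expr0 ?expr1; field.
under eq_bigr do rewrite expr_div_n mulrA sdE.
rewrite -mulr_suml (_ : \sum_c _ = 1 + p * h ^+ 2) ?divff// -?sdE ?expf_neq0//.
rewrite sdE sum_pair sum_pair !big_bool /mixed_weight /mixed /prior /coin /signal.
by rewrite /sgnb/= ?expr0 ?expr1; field.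
Qed.

Lemma norm_sgnb b : `|sgnb b| = 1.
Proof. by rewrite /sgnb normrX normrN1 expr1n. Qed.

Lemma rademacher_tail t : 2 <= t -> rademacher [set x | (t < `|x|)%R] = 0%E.
Proof.
move=> t2; rewrite /rademacher/= discrete_law_tail big_pred0// => b.
by rewrite norm_sgnb; apply/negbTE; rewrite -leNgt; lra.
Qed.

(** Dividing by [mixed_sd], at least 1, only shrinks the atoms. Without signal an atom has modulus
    at most 1 < 2, with signal at most 1 + h. So the tail beyond [t] has mass at most p, and none
    once t >= 1 + h. *)
Lemma mixed_law_tail t b : 2 <= t -> 0 <= b -> (t < 1 + h -> p <= b) ->
  (mixed_law [set x | (t < `|x|)%R] <= b%:E)%E.
Proof.
move=> t2 b0 pb; rewrite /mixed_law/= discrete_law_tail lee_fin.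
have normE c : `|mixed c / mixed_sd| <= `|mixed c|.
  rewrite normrM normfV (gtr0_norm mixed_sd_gt0) ler_piMr//.
  by rewrite invf_le1 ?mixed_sd_ge1 ?mixed_sd_gt0.
have tlt c : t < `|mixed c / mixed_sd| -> c.1.1 /\ t < 1 + h.
  move=> /lt_le_trans /(_ (normE c)).
  rewrite /mixed /signal; case: ifP => _; last first.
    by rewrite add0r norm_sgnb => ?; lra.
  move=> /lt_le_trans /(_ (ler_normD _ _)).
  by rewrite normrM !norm_sgnb mulr1 gtr0_norm// addrC.
have [/pb {}pb|th] := ltP t (1 + h); last first.
  rewrite big_pred0// => c; apply/negP => /tlt[_]; lra.
apply: le_trans pb.
apply: (@le_trans _ _ (\sum_(c : bool * bool * bool | c.1.1) mixed_weight c)).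
  rewrite big_mkcond [leRHS]big_mkcond; apply: ler_sum => c _.
  case: ifPn => [/tlt[-> _]//|_]; case: ifP => // _; exact: mixed_weight_ge0.
rewrite big_mkcond sum_pair sum_pair !big_bool/= /mixed_weight /prior /coin/=.
by rewrite !addr0; lra.
Qed.

Lemma l2norm_signal n t : size t = n ->
  l2norm (tuple_map n signal t) = h * Num.sqrt (count fst t)%:R.
Proof.
move=> st; rewrite /l2norm.
rewrite (sum_tuple_map (fun a : bool * bool => h ^+ 2 * (a.1 : nat)%:R) signal
  (fun y => y ^+ 2))//; last first.
  move=> a; rewrite /signal; case: ifP => _; last by rewrite mulr0 expr0n.
  by rewrite exprMn -[sgnb _ ^+ 2]real_normK ?num_real// norm_sgnb expr1n.
rewrite -mulr_sumr sqrtrM ?sqr_ge0// sqrtr_sqr gtr0_norm//.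
rewrite -sum1_count natr_sum [in RHS]big_mkcond; congr (_ * Num.sqrt _).
by apply: eq_bigr => -[[] ?].
Qed.

Lemma l0norm_signal n t : size t = n ->
  l0norm (tuple_map n signal t) = count fst t.
Proof.
move=> st; rewrite /l0norm -sum1_card.
rewrite (eq_bigl (fun i => tnth (tuple_map n signal t) i != 0)); last first.
  by move=> i; apply/idP/idP; rewrite inE.
apply/eqP; rewrite -(eqr_nat R) natr_sum big_mkcond/=.
rewrite (sum_tuple_map (fun a : bool * bool => (a.1 : nat)%:R) signal
  (fun y => if y != 0 then 1 else 0))//.
  rewrite -sum1_count natr_sum [in eqbRHS]big_mkcond; apply/eqP.
  by apply: eq_bigr => -[[] ?].
move=> [[] b]; rewrite /signal/= ?eqxx//.
by rewrite -normr_gt0 normrM norm_sgnb mulr1 (gtr0_norm h0) h0.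
Qed.

End Contamination.

(** * The number of nonzero coordinates *)

Section CountMoment.
Context {R : realType} {J : finType}.
Variables (w : J -> R) (a : pred J) (s d : nat).
Hypotheses (s_gt0 : (0 < s)%N) (d_gt0 : (0 < d)%N).

(* [window k] is positive only for [s / 12 < k <= s], and then at most [1]. *)
Definition window (k : nat) : R :=
  (k%:R - s%:R / 12) * (s%:R + 1 - k%:R) / s%:R ^+ 2.

Lemma window_gt0 k : 0 < window k -> s%:R / 12 < k%:R :> R /\ (k <= s)%N.
Proof.
have s0 : 0 < s%:R :> R by rewrite ltr0n.
rewrite /window pmulr_lgt0 ?invr_gt0 ?exprn_gt0// => g0.
(* The upper root is s + 1 rather than s so that k = s still counts; no integer above s gets in. *)
have ks : k%:R < s%:R + 1 :> R.
  rewrite ltNge; apply/negP => sk; move: g0; rewrite ltNge => /negP; apply.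
  by rewrite mulr_ge0_le0//; lra.
split; last by rewrite -ltnS -(ltr_nat R) -natr1.
rewrite ltNge; apply/negP => ks'; move: g0; rewrite ltNge => /negP; apply.
by rewrite mulr_le0_ge0//; lra.
Qed.

Lemma window_le1 k : 0 < window k -> window k <= 1.
Proof.
move=> /window_gt0[k1 k2].
have s1 : 1 <= s%:R :> R by rewrite ler1n.
have {}k2 : k%:R <= s%:R :> R by rewrite ler_nat.
rewrite /window ler_pdivrMr ?exprn_gt0 ?mul1r//; last lra.
by nra.
Qed.

(** The window is quadratic, so its mean depends only on the mean s / 2 of the count and on its
    variance, at most s / 2. With [window_gt0] and [window_le1] this replaces a tail estimate for
    the binomial law. *)
Lemma iid_mean_window : \sum_j w j = 1 ->
  \sum_(j | a j) w j = s%:R / (2 * d%:R) ->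
  8^-1 <= iid_mean w d (fun t => window (count a t)).
Proof.
move=> w1 wp; have s1 : 1 <= s%:R :> R by rewrite ler1n.
have d1 : 1 <= d%:R :> R by rewrite ler1n.
have windowE t : window (count a t) = - (s%:R + 1) / (12 * s%:R) +
    ((s%:R + 1 + s%:R / 12) / s%:R ^+ 2 * (count a t)%:R +
    (- (s%:R ^+ 2)^-1) * (count a t)%:R ^+ 2).
  by rewrite /window; field; lra.
rewrite (eq_iid_mean _ _ _ _ windowE) !iid_meanD iid_mean_cst// !iid_meanZ.
rewrite (iid_mean_count _ _ _ _ w1 wp) (iid_mean_count_sqr _ _ _ _ w1 wp).
set p := s%:R / (2 * d%:R).
have dp : d%:R * p = s%:R / 2 by rewrite /p; field; lra.
have dp2 : d%:R * (p - p ^+ 2) <= s%:R / 2.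
  by rewrite -dp ler_wpM2l ?ler0n// lerBlDr lerDl sqr_ge0.
rewrite dp -subr_ge0.
set D := d%:R * _ in dp2 *.
(* The excess over 1 / 8: the slack in the variance bound plus s (s - 1) / 12, both nonnegative,
   over s ^ 2. *)
rewrite (_ : _ - _ = ((s%:R / 2 - D) + s%:R * (s%:R - 1) / 12) / s%:R ^+ 2).
  by rewrite divr_ge0 ?sqr_ge0// addr_ge0//; nra.
by field; lra.
Qed.

End CountMoment.

(** * Lower bound for a class described by a tail bound *)

Section LowerBound.
Context {R : realType}.
Variables (cls : probability R R -> Prop) (B : R -> R).
Hypothesis cls_tail : forall P, centered_unit_var P ->
  (forall t : R, 2 <= t -> (P [set x | (t < `|x|)%R] <= (B t)%:E)%E) -> cls P.
Hypothesis B_ge0 : forall t : R, 2 <= t -> 0 <= B t.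
Variables (l : R -> R) (l_loss : loss_class l).

Lemma loss_ge0 y : 0 <= y -> 0 <= l y.
Proof. by case: l_loss => _ _ + _; exact. Qed.

Lemma ler_loss x y : 0 <= x -> x <= y -> l x <= l y.
Proof. by case: l_loss => + _ _ _; exact. Qed.

Variables (s d : nat) (T : d.-tuple R -> R) (k p h A : R).
Hypotheses (s_gt0 : (0 < s)%N) (s_le_d : (s <= d)%N).
Hypothesis pE : p = s%:R / (2 * d%:R).
Hypotheses (h_gt0 : 0 < h) (k_ge0 : 0 <= k) (A_ge0 : 0 <= A).
(** [tail_h] lets the contaminated noise into the class; [sep] makes the sparse norm, times [k], at
    least the sum of the errors allowed in the two readings. *)
Hypothesis tail_h : forall t : R, 2 <= t -> t < 1 + h -> p <= B t.
Hypothesis sep : A * (mixed_sd p h + 1) <= k * (h * Num.sqrt (s%:R / 12)).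

Let d_gt0 : (0 < d)%N. Proof. exact: leq_trans s_le_d. Qed.

Let p_ge0 : 0 <= p.
Proof. by rewrite pE divr_ge0// mulr_ge0. Qed.

Let p_le1 : p <= 1.
Proof.
have : s%:R <= d%:R :> R by rewrite ler_nat.
have : 1 <= d%:R :> R by rewrite ler1n.
by move=> ? ?; rewrite pE ler_pdivrMr; lra.
Qed.

Let sd_gt0 := mixed_sd_gt0 p h p_ge0.

Let risk_le_max_risk P sigma th : cls P -> 0 < sigma -> (l0norm th <= s)%N ->
  (risk l k T P sigma th <= max_risk cls l k s T)%E.
Proof. by move=> ? ? ?; apply: ereal_sup_ubound; exists P, sigma, th. Qed.

Let loss_arg_ge0 (x y : R) : 0 < y -> 0 <= l (k * (`|x| / y)).
Proof. by move=> y0; rewrite loss_ge0// mulr_ge0// divr_ge0// ltW. Qed.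

(** First reading: theta = 0, sigma = [mixed_sd]. Scaling the standardised noise back by sigma
    returns the atoms of [mixed]. *)
Lemma null_risk :
  ((iid_mean (mixed_weight p) d (fun c =>
     l (k * (`|T (tuple_map d (mixed h) c)| / mixed_sd p h))))%:E <=
   max_risk cls l k s T)%E.
Proof.
pose th : d.-tuple R := [tuple 0 | i < d].
have th0 i : tnth th i = 0 by rewrite tnth_mktuple.
have cP : cls (mixed_law p h p_ge0 p_le1).
  apply: cls_tail; first exact: mixed_law_centered.
  by move=> t t2; apply: mixed_law_tail => //; [exact: B_ge0|exact: tail_h].
apply: le_trans (risk_le_max_risk _ _ th cP sd_gt0 _); last first.
  rewrite /l0norm eq_card0// => i; apply/negbTE/negP.
  by rewrite inE /= th0 eqxx.
pose f xi := l (k * (`|T (obs th (mixed_sd p h) xi) - l2norm th| / mixed_sd p h)).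
apply: le_trans (iid_mean_le_prod_expect _ _ _ _ _ f _); last first.
  by move=> t; exact: loss_arg_ge0.
rewrite lee_fin; apply: ler_iid_mean => [j|t _]; first exact: mixed_weight_ge0.
rewrite /f (_ : l2norm th = 0); last first.
  by rewrite /l2norm big1 ?sqrtr0// => i _; rewrite th0 expr0n.
rewrite subr0 (_ : obs _ _ _ = tuple_map d (mixed h) t)//.
apply: eq_from_tnth => i; rewrite !tnth_mktuple add0r.
(* Past the end of [t] both sides read the default 0. *)
have [it|it] := ltnP i (size t); last first.
  by rewrite !nth_default ?size_map// mulr0.
by rewrite !(nth_map (false, false, false))// mulrC divfK// gt_eqF.
Qed.

(** Second reading, for a fixed signal and sigma = 1: signal plus Rademacher noise is [mixed] of the
    zipped sequences, the same data as in the first reading. *)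
Lemma sparse_risk a : size a = d -> (count fst a <= s)%N ->
  ((iid_mean coin d (fun b =>
     l (k * (`|T (tuple_map d (mixed h) (zip a b)) -
               h * Num.sqrt (count fst a)%:R| / 1))))%:E <=
   max_risk cls l k s T)%E.
Proof.
move=> sa ca; set th := tuple_map d (signal h) a.
have cP : cls rademacher.
  apply: cls_tail; first exact: rademacher_centered.
  by move=> t t2; rewrite rademacher_tail// lee_fin B_ge0.
apply: le_trans (risk_le_max_risk _ 1 th cP ltr01 _); last first.
  by rewrite l0norm_signal.
pose f xi := l (k * (`|T (obs th 1 xi) - l2norm th| / 1)).
apply: le_trans (iid_mean_le_prod_expect _ _ _ _ _ f _); last first.
  by move=> t; exact: loss_arg_ge0.
rewrite lee_fin; apply: ler_iid_mean => [j|b sb]; first exact: coin_ge0.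
rewrite /f l2norm_signal// (_ : obs _ _ _ = tuple_map d (mixed h) (zip a b))//.
apply: eq_from_tnth => i; rewrite !tnth_mktuple mul1r.
rewrite !(nth_map (false, false)) ?sa//.
rewrite (nth_map false) ?sb// (nth_map (false, false, false)); last first.
  by rewrite size_zip sa sb minnn.
by rewrite nth_zip ?sa.
Qed.

(* The observation is the same under both models, so an estimator cannot be
   close to 0 and to the sparse norm at once. *)
Lemma loss_separation (y : R) (n : nat) : s%:R / 12 <= n%:R :> R ->
  l A <= l (k * (`|y| / mixed_sd p h)) + l (k * (`|y - h * Num.sqrt n%:R| / 1)).
Proof.
move=> sn; set v := h * _.
have hv : A * (mixed_sd p h + 1) <= k * v.
  apply: le_trans sep _; apply: ler_wpM2l => //; rewrite ler_pM2l//.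
  exact: ler_wsqrtr.
have [Ay|yA] := leP A (k * (`|y| / mixed_sd p h)).
  by apply: le_trans (ler_loss _ _ A_ge0 Ay) _; rewrite lerDl loss_arg_ge0.
have [Ay'|y'A] := leP A (k * (`|y - v| / 1)).
  by apply: le_trans (ler_loss _ _ A_ge0 Ay') _; rewrite lerDr loss_arg_ge0.
exfalso; move: yA y'A; rewrite divr1 mulrA ltr_pdivrMr// => y1 y2.
have : v <= `|y| + `|y - v|.
  by apply: le_trans (ler_norm v) _; rewrite -{1}(subKr y v) ler_normB.
move=> /(ler_wpM2l k_ge0); rewrite mulrDr => hk; lra.
Qed.

(** Averages [loss_separation] over noise and signal: both readings are bounded by the same maximal
    risk, so l A / 8 is at most twice that risk. *)
Lemma max_risk_ge : ((l A / 16)%:E <= max_risk cls l k s T)%E.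
Proof.
have nr := null_risk.
(* [null_risk] rules out the value -oo, and +oo makes the bound trivial. *)
have [M ME] : exists M, max_risk cls l k s T = M%:E \/ max_risk cls l k s T = +oo%E.
  case: (max_risk _ _ _ _ _) nr => [r| |]//= _; last by exists 0; right.
  by exists r; left.
case: ME => ME; last by rewrite ME leey.
rewrite ME lee_fin in nr; rewrite ME lee_fin.
have sr a : size a = d -> (count fst a <= s)%N -> iid_mean coin d (fun b =>
     l (k * (`|T (tuple_map d (mixed h) (zip a b)) -
               h * Num.sqrt (count fst a)%:R| / 1))) <= M.
  by move=> sa ca; have := sparse_risk a sa ca; rewrite ME lee_fin.
rewrite iid_mean_zip in nr.
set f0 := fun a => iid_mean coin d _ in nr.
have f0_ge0 a : 0 <= f0 a.
  rewrite -[leLHS](iid_mean_cst coin d _ sum_coin).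
  by apply: ler_iid_mean => [j|b _]; [exact: coin_ge0|exact: loss_arg_ge0].
have M0 : 0 <= M.
  apply: le_trans nr; rewrite -[leLHS](iid_mean_cst (prior p) d _ (sum_prior p)).
  by apply: ler_iid_mean => // j; exact: prior_ge0.
have lA0 : 0 <= l A by exact: loss_ge0.
(* Where the window is not positive the left side is at most 0; this covers the signals with too
   many nonzero entries, to which [sparse_risk] does not apply. *)
have key a : size a = d -> l A * window s (count fst a) <= M + f0 a.
  move=> sa; have [w0|w0] := leP (window s (count fst a)) (0 : R).
    by apply: (@le_trans _ _ 0); rewrite ?addr_ge0// mulr_ge0_le0.
  have [sc cs] := window_gt0 _ s_gt0 _ w0.
  apply: (@le_trans _ _ (l A)).
    by rewrite ler_piMr// window_le1.
  apply: le_trans (lerD (sr a sa cs) (lexx _)); rewrite addrC /f0 -iid_meanD.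
  rewrite -[leLHS](iid_mean_cst coin d _ sum_coin).
  apply: ler_iid_mean => [j|b _]; first exact: coin_ge0.
  exact/loss_separation/ltW.
have := @ler_iid_mean _ _ (prior p) d _ _ (prior_ge0 _ p_ge0 p_le1) key.
rewrite iid_meanZ iid_meanD iid_mean_cst ?sum_prior//.
have := iid_mean_window (prior p) fst s d s_gt0 d_gt0 (sum_prior p).
rewrite sum_prior_signal => /(_ pE) /(ler_wpM2l lA0) h1 h2.
lra.
Qed.

End LowerBound.

(* [L] is the quantile scale of the class at level [p]: the tail bound [B]
   is at least [p] up to [tau * L].  [Phi] is the rate without the constants. *)
Lemma rate_lower_bound {R : realType} (cls : probability R R -> Prop)
    (B : R -> R) (l : R -> R) (tau C A Phi L : R) (s d : nat) (T : d.-tuple R -> R) :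
  (forall P, centered_unit_var P ->
    (forall t : R, 2 <= t -> (P [set x | (t < `|x|)%R] <= (B t)%:E)%E) -> cls P) ->
  (forall t : R, 2 <= t -> 0 <= B t) -> loss_class l ->
  0 < tau -> 0 <= C -> 0 <= A -> 0 < Phi -> (0 < s)%N -> (s <= d)%N ->
  Phi <= L ->
  let p := s%:R / (2 * d%:R) in
  (forall t, 2 <= t -> t <= tau * L -> p <= B t) ->
  p * L ^+ 2 <= C ->
  ((l A / 16)%:E <= max_risk cls l
     (8 * A * (3 + tau ^+ 2 * C) / tau / (Num.sqrt s%:R * Phi)) s T)%E.
Proof.
move=> clsB B0 ll tau0 C0 A0 Phi0 s0 sd PhiL p pB pL.
have s1 : 1 <= s%:R :> R by rewrite ler1n.
have d1 : s%:R <= d%:R :> R by rewrite ler_nat.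
have p0 : 0 <= p by rewrite divr_ge0// mulr_ge0.
have p1 : p <= 1 by rewrite ler_pdivrMr; lra.
have K0 : 0 <= 3 + tau ^+ 2 * C by rewrite addr_ge0// mulr_ge0// sqr_ge0.
have S0 : 0 < Num.sqrt s%:R :> R by rewrite sqrtr_gt0; lra.
have tauL : 0 < tau * L by rewrite mulr_gt0//; exact: lt_le_trans PhiL.
(* The largest h with 1 + h <= tau L, but at least 1; when h = 1 the range 2 <= t < 1 + h is empty.
   In both cases h >= tau L / 2. *)
pose h := Num.max 1 (tau * L - 1).
have h0 : 0 < h by rewrite lt_max ltr01.
have hL : tau * L / 2 <= h.
  by rewrite /h; case: (leP 1 (tau * L - 1)) => ?; lra.
have ph : p * h ^+ 2 <= 1 + tau ^+ 2 * C.
  rewrite /h; case: (leP 1 (tau * L - 1)) => hlt; last first.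
    by rewrite expr1n mulr1; apply: le_trans p1 _; rewrite lerDl mulr_ge0// sqr_ge0.
  apply: (@le_trans _ _ (p * (tau * L) ^+ 2)).
    by rewrite ler_wpM2l// ler_sqr ?nnegrE; lra.
  rewrite exprMn mulrCA; apply: (@le_trans _ _ (tau ^+ 2 * C)); last by lra.
  by rewrite ler_wpM2l// sqr_ge0.
have msd : mixed_sd p h + 1 <= 3 + tau ^+ 2 * C.
  suff : mixed_sd p h <= 2 + tau ^+ 2 * C by lra.
  have q0 : 0 <= tau ^+ 2 * C by rewrite mulr_ge0// sqr_ge0.
  rewrite /mixed_sd -(@ger0_norm _ (2 + _)) ?addr_ge0//.
  rewrite -sqrtr_sqr ler_wsqrtr//; move: ph q0; set q := tau ^+ 2 * C => ph q0.
  nra.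
apply: (max_risk_ge cls B clsB B0 l ll s d T _ p h) => //.
- by rewrite divr_ge0// ?mulr_ge0 ?invr_ge0// ltW.
- move=> t t2; rewrite /h; case: (leP 1 (tau * L - 1)) => hlt tlt; last by lra.
  by apply: pB => //; lra.
- apply: (@le_trans _ _ (A * (3 + tau ^+ 2 * C))); first exact: ler_wpM2l.
  (* Since 12 <= 16. With h >= tau L / 2 this loses the factor 8 that the constant in the scale
     makes up for. *)
  have s12 : Num.sqrt s%:R / 4 <= Num.sqrt (s%:R / 12) :> R.
    rewrite (_ : 4 = Num.sqrt (4 ^+ 2)); last by rewrite sqrtr_sqr ger0_norm.
    rewrite -sqrtrV ?sqr_ge0// -sqrtrM ?ler0n//.
    by rewrite ler_wsqrtr//; lra.
  apply: (@le_trans _ _ (8 * A * (3 + tau ^+ 2 * C) / tau /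
      (Num.sqrt s%:R * Phi) * (tau * Phi / 2 * (Num.sqrt s%:R / 4)))).
    rewrite (_ : _ * (_ * _) = A * (3 + tau ^+ 2 * C))//.
    by field; rewrite !gt_eqF.
  apply: ler_wpM2l; first by rewrite divr_ge0// ?mulr_ge0 ?invr_ge0// ltW.
  have tP0 : 0 <= tau * Phi / 2 by rewrite divr_ge0// mulr_ge0// ltW.
  have S40 : 0 <= Num.sqrt s%:R / 4 :> R by rewrite divr_ge0.
  apply: ler_pM tP0 S40 _ s12.
  apply: le_trans hL; rewrite ler_wpM2r ?invr_ge0// ler_wpM2l//; exact: ltW.
Qed.

(** With b = 2 / a: u / b <= exp (u / b), raised to the power b, gives u ^ b <= b ^ b exp u. This
    bounds p L ^ 2 when p is a constant times exp (- u) and L = u ^ (1 / a). *)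
Lemma expR_powR_le {R : realType} (a u : R) : 0 < a -> 0 < u ->
  expR (- u) * (u `^ a^-1) ^+ 2 <= (2 / a) `^ (2 / a).
Proof.
move=> a0 u0.
have b0 : 0 < 2 / a by rewrite divr_gt0.
have v0 : 0 <= u / (2 / a) by rewrite divr_ge0// ltW.
have -> : (u `^ a^-1) ^+ 2 = u `^ (2 / a).
  by rewrite -powR_mulrn ?powR_ge0// -powRrM mulrC.
have uE : u = (2 / a) * (u / (2 / a)) by field; lra.
rewrite {2}uE powRM ?(ltW b0)// mulrCA ler_piMr ?powR_ge0//.
rewrite expRN mulrC ler_pdivrMr ?expR_gt0// mul1r.
have -> : expR u = expR (u / (2 / a)) `^ (2 / a).
  by rewrite -expRM divfK// gt_eqF.
apply: ge0_ler_powR; rewrite ?nnegrE ?expR_ge0 ?(ltW b0)//.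
apply: le_trans (expR_ge1Dx _); lra.
Qed.

(** * Application to the exponential and the polynomial tails *)

Theorem theorem2 (R : realType) (l : R -> R) (hl : loss_class l) :
  (forall a tau : R, 0 < a -> 0 < tau ->
    exists c c' : R, 0 < c /\ 0 < c' /\
      forall s d : nat, (1 <= s)%N -> (s <= d)%N ->
      forall T : d.-tuple R -> R, measurable_fun setT T ->
        (c'%:E <= max_risk (subweibull_class a tau) l
           (c / (Num.sqrt (s%:R) * (ln (expR 1 * d%:R / s%:R)) `^ (a^-1))) s T)%E)
  /\
  (forall a tau : R, 2 <= a -> 0 < tau ->
    exists c c' : R, 0 < c /\ 0 < c' /\
      forall s d : nat, (1 <= s)%N -> (s <= d)%N ->
      forall T : d.-tuple R -> R, measurable_fun setT T ->
        (c'%:E <= max_risk (polytail_class a tau) l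
           (c / (Num.sqrt (s%:R) * (d%:R / s%:R) `^ (a^-1))) s T)%E).
Proof.
(* The error threshold A is a point where the loss is positive, hence not 0. *)
have [A A0 lA0] : exists2 A, 0 < A & 0 < l A.
  have [_ l0 l_ge0 [A [A0 lA]]] := hl.
  exists A; last by rewrite lt_def lA l_ge0.
  by rewrite lt_def A0 andbT; apply: contraNneq lA => ->; rewrite l0.
have c_gt0 (tau C : R) : 0 < tau -> 0 <= C ->
    0 < 8 * A * (3 + tau ^+ 2 * C) / tau.
  move=> tau0 C0; rewrite divr_gt0// mulr_gt0 ?mulr_gt0// ltr_wpDr//.
  by rewrite mulr_ge0// sqr_ge0.
have c'_gt0 : 0 < l A / 16 by rewrite divr_gt0.
split=> a tau a0 tau0.
(* The factor 2 comes from p = 2 exp (- ln (2 / p)). *)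
- pose C := 2 * (2 / a) `^ (2 / a).
  have C0 : 0 <= C by rewrite mulr_ge0// powR_ge0.
  exists (8 * A * (3 + tau ^+ 2 * C) / tau), (l A / 16).
  split; [exact: c_gt0|split=> // s d s1 sd T _].
  have S1 : 1 <= s%:R :> R by rewrite ler1n.
  have D1 : s%:R <= d%:R :> R by rewrite ler_nat.
  have e2 : 2 <= expR 1 :> R by have := expR_ge1Dx (1 : R); lra.
  (* This gives e d / s <= 4 d / s = 2 / p, so the rate is at most ln (2 / p) ^ (1 / a), the
     quantile scale at level p. *)
  have e4 : expR 1 <= 4 :> R.
    have h2 : 2^-1 <= expR (- 2^-1) :> R by have := expR_ge1Dx (- 2^-1 : R); lra.
    have -> : expR 1 = (expR (- 2^-1))^-1 ^+ 2 :> R.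
      by rewrite -expRN opprK expr2 -expRD; congr expR; field.
    have h3 : (expR (- 2^-1))^-1 <= 2 :> R by rewrite invf_ple ?posrE ?expR_gt0.
    rewrite (_ : 4 = 2 ^+ 2); last by ring.
    by rewrite ler_sqr ?nnegrE ?invr_ge0 ?expR_ge0.
  set p : R := s%:R / (2 * d%:R).
  have p0 : 0 < p by rewrite divr_gt0//; lra.
  have lnp : ln (expR 1 * d%:R / s%:R) <= ln (2 / p) :> R.
    rewrite ler_ln ?posrE ?divr_gt0 ?mulr_gt0//; try lra.
    rewrite (_ : 2 / p = 4 * d%:R / s%:R); last by rewrite /p; field; lra.
    rewrite ler_pM2r ?invr_gt0; last by lra.
    by rewrite ler_pM2r//; lra.
  have ln0 : 0 < ln (expR 1 * d%:R / s%:R) :> R.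
    apply: ln_gt0; rewrite -mulrA; apply: (@lt_le_trans _ _ (expR 1)); first by lra.
    by rewrite ler_peMr ?expR_ge0// ler_pdivlMr; lra.
  have lnp0 : 0 < ln (2 / p) by exact: lt_le_trans lnp.
  have pexp : p = 2 * expR (- ln (2 / p)).
    have p2 : 0 < 2 / p by rewrite divr_gt0.
    by rewrite expRN lnK ?posrE//; field; lra.
  apply: (rate_lower_bound _ (fun t => 2 * expR (- (t / tau) `^ a)) _ _ _ _ _
    (ln (2 / p) `^ a^-1)) => //.
  + exact: (ltW A0).
  + exact: powR_gt0.
  + apply: ge0_ler_powR => //; rewrite ?nnegrE ?invr_ge0; exact: ltW.
  + move=> t t2 tL; rewrite -/p {1}pexp ler_pM2l// ler_expR lerN2.
    have lnE : ln (2 / p) = (ln (2 / p) `^ a^-1) `^ a.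
      by rewrite -powRrM mulVf ?gt_eqF// powRr1// ltW.
    rewrite [leRHS]lnE; apply: ge0_ler_powR; rewrite ?nnegrE ?(ltW a0) ?powR_ge0//.
      by rewrite divr_ge0// ltW//; lra.
    by rewrite ler_pdivrMr// mulrC.
  + by rewrite -/p {1}pexp -mulrA ler_pM2l// expR_powR_le.
(* Here C = 1: for L = p ^ (- 1 / a), p L ^ 2 = p ^ (1 - 2 / a) <= 1 because p <= 1 and a >= 2. *)
- exists (8 * A * (3 + tau ^+ 2 * 1) / tau), (l A / 16).
  split; [exact: c_gt0|split=> // s d s1 sd T _].
  have S1 : 1 <= s%:R :> R by rewrite ler1n.
  have D1 : s%:R <= d%:R :> R by rewrite ler_nat.
  set p : R := s%:R / (2 * d%:R).
  have p0 : 0 < p by rewrite divr_gt0//; lra.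
  have p1 : p <= 1 by rewrite /p ler_pdivrMr; lra.
  have ap : 0 < a by lra.
  have ds0 : 0 < d%:R / s%:R :> R by rewrite divr_gt0//; lra.
  apply: (rate_lower_bound _ (fun t => (tau / t) `^ a) _ _ _ _ _
    (p^-1 `^ a^-1)) => //.
  + by move=> t _; rewrite powR_ge0.
  + exact: (ltW A0).
  + exact: powR_gt0.
  (* The rate is below the quantile scale because d / s <= 2 d / s = 1 / p. *)
  + apply: ge0_ler_powR; rewrite ?nnegrE ?invr_ge0 ?(ltW p0) ?(ltW ap) ?(ltW ds0)//.
    by rewrite /p invf_div ler_pM2r ?invr_gt0; lra.
  + move=> t t2 tL; rewrite -/p.
    have pEa : p = (p `^ a^-1) `^ a.
      by rewrite -powRrM mulVf ?gt_eqF// powRr1// ltW.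
    rewrite [leLHS]pEa; apply: ge0_ler_powR; rewrite ?nnegrE ?(ltW ap) ?powR_ge0//.
      by rewrite divr_ge0// ltW//; lra.
    rewrite ler_pdivlMr; last by lra.
    apply: le_trans (ler_wpM2l (powR_ge0 _ _) tL) _.
    rewrite mulrCA -powRM ?invr_ge0 ?(ltW p0)// divff ?gt_eqF//.
    by rewrite powR1 mulr1.
  + rewrite -/p -powR_mulrn ?powR_ge0// -powRrM.
    rewrite -ler_pdivlMl// mulr1 -[leRHS]powRr1 ?invr_ge0 ?(ltW p0)//.
    rewrite ler_powR ?invf_ge1// ler_pdivrMl// mulr1; lra.
Qed.
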